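(* Let $k,n\ge 1$ be integers, $m=kn-1$, and equip $\mathbb P_m\mathbb C$ with the metric $g$ and group $G_{n,k}$ described in the context (for some fixed constant $a_m>0$). Let $\varphi\in C^\infty(\mathbb P_m\mathbb C)$ be $g$-admissible and $G_{n,k}$-invariant, with $\sup_{\mathbb P_m\mathbb C}\varphi=0$. Then $\varphi\ge\psi$ on $\mathbb P_m\mathbb C$, where $$\psi([z_0,\dots,z_m])=\ln\frac{(|z_0|\cdots|z_m|)^{2a_m/(m+1)}}{(|z_0|^2+\cdots+|z_m|^2)^{a_m}}$$ (with $\psi=-\infty$ where some $z_p=0$).
   Context: Homogeneous coordinates on $\mathbb P_m\mathbb C$, $m=kn-1$, are written $[z_0,\dots,z_m]=[Z_0,\dots,Z_{k-1}]$ with blocks $Z_h=(z_{hn},\dots,z_{(h+1)n-1})\in\mathbb C^n$, $h=0,\dots,k-1$. The metric $g$ is $a_m$ times the Fubini–Study metric: in the chart $\{z_0\neq0\}$ (with $z_0=1$) its components are $g_{\lambda\bar\mu}=a_m\,\partial^2\ln(1+|z_1|^2+\cdots+|z_m|^2)/\partial z_\lambda\partial\bar z_\mu$, and similarly in the other standard charts. A function $\varphi\in C^\infty(\mathbb P_m\mathbb C)$ is $g$-admissible if the Hermitian matrix $g_{\lambda\bar\mu}+\partial^2\varphi/\partial z_\lambda\partial\bar z_\mu$ is positive definite everywhere (in local holomorphic coordinates). $G_{n,k}$ is the group of automorphisms of $\mathbb P_m\mathbb C$ generated by: the block swaps $[Z_0,\dots,Z_i,\dots,Z_j,\dots,Z_{k-1}]\mapsto[Z_0,\dots,Z_j,\dots,Z_i,\dots,Z_{k-1}]$;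 the phase rotations multiplying a single homogeneous coordinate $z_p$ by $e^{i\theta}$ ($\theta\in\mathbb R$); and the transpositions exchanging $z_p$ and $z_q$ whenever $z_p,z_q$ belong to the same block $Z_h$. The function $\psi$ is homogeneous of degree $0$, hence well defined on $\mathbb P_m\mathbb C$. *)

(* Defs.v *)
From HB Require Import structures.
From mathcomp Require Import all_boot all_order all_algebra.
From mathcomp Require Import all_classical all_reals all_analysis.
From mathcomp Require Import complex.

Set Implicit Arguments.
Unset Strict Implicit.
Unset Printing Implicit Defensive.

Import Order.TTheory GRing.Theory Num.Theory.
Import numFieldNormedType.Exports.
Local Open Scope ring_scope.
Local Open Scope complex_scope.

Fixpoint Ck {R : realType} {V : normedModType R} (k : nat) (f : V -> R) : Prop :=
  match k with
  | 0%N => continuous f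
  | k'.+1 => (forall x, differentiable f x) /\ forall v : V, Ck k' ('D_v f)
  end.

Definition smooth {R : realType} {V : normedModType R} (f : V -> R) : Prop :=
  forall k, Ck k f.

(* Homogeneous coordinates of P_m C : vectors z : 'I_m.+1 -> R[i]. *)
Definition hvec (R : realType) (m : nat) := 'I_m.+1 -> R[i].

Definition hnonzero {R : realType} {m : nat} (z : hvec R m) : Prop :=
  exists p, z p != 0.

(* A function on C^{m+1}\{0} descends to P_m C iff it is invariant
   under multiplication by nonzero complex scalars. *)
Definition homog0 {R : realType} {m : nat} (phi : hvec R m -> R) : Prop :=
  forall (l : R[i]) (z : hvec R m), l != 0 -> phi (fun p => l * z p) = phi z.

(* Standard affine chart {z_p <> 0} of P_m C, with coordinates
   w_j = z_{lift p j}/z_p = u_j + i v_j, j : 'I_m ; x = (u, v). *)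
Definition chart {R : realType} {m : nat} (p : 'I_m.+1)
    (x : 'rV[R]_m * 'rV[R]_m) : hvec R m :=
  fun q => match unlift p q with
           | None => 1
           | Some j => (x.1 0 j) +i* (x.2 0 j)
           end.

Definition inchart {R : realType} {m : nat} (p : 'I_m.+1) (phi : hvec R m -> R)
    : 'rV[R]_m * 'rV[R]_m -> R := fun x => phi (chart p x).

Definition du {R : realType} {m : nat} (j : 'I_m) : 'rV[R]_m * 'rV[R]_m :=
  (delta_mx 0 j, 0).
Definition dv {R : realType} {m : nat} (j : 'I_m) : 'rV[R]_m * 'rV[R]_m :=
  (0, delta_mx 0 j).

Definition d2 {R : realType} {m : nat} (e1 e2 : 'rV[R]_m * 'rV[R]_m)
    (F : 'rV[R]_m * 'rV[R]_m -> R) (x : 'rV[R]_m * 'rV[R]_m) : R :=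
  'D_e1 ('D_e2 F) x.

(* complex Hessian  d^2 F / dw_l d(conj w_mu), with
   d/dw = (d/du - i d/dv)/2 , d/d(conj w) = (d/du + i d/dv)/2 *)
Definition cHess {R : realType} {m : nat} (F : 'rV[R]_m * 'rV[R]_m -> R)
    (x : 'rV[R]_m * 'rV[R]_m) : 'M[R[i]]_m :=
  \matrix_(l, mu)
    (((d2 (du l) (du mu) F x + d2 (dv l) (dv mu) F x) / 4%:R)
      +i* ((d2 (du l) (dv mu) F x - d2 (dv l) (du mu) F x) / 4%:R)).

Definition posdef {R : realType} {m : nat} (H : 'M[R[i]]_m) : Prop :=
  forall xi : 'cV[R[i]]_m, xi != 0 ->
    0 < \sum_(l < m) \sum_(mu < m) H l mu * xi l 0 * (xi mu 0)^*.

Definition fs_pot {R : realType} {m : nat} (x : 'rV[R]_m * 'rV[R]_m) : R :=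
  ln (1 + \sum_(j < m) (x.1 0 j ^+ 2 + x.2 0 j ^+ 2)).

(* g = a * Fubini-Study ; phi is g-admissible if g_{l mu} + phi_{l mu}
   is positive definite everywhere, in every standard chart. *)
Definition admissible {R : realType} {m : nat} (a : R) (phi : hvec R m -> R)
  : Prop :=
  forall (p : 'I_m.+1) (x : 'rV[R]_m * 'rV[R]_m),
    posdef (cHess (fun y => a * fs_pot y) x + cHess (inchart p phi) x).

Definition smoothP {R : realType} {m : nat} (phi : hvec R m -> R) : Prop :=
  forall p : 'I_m.+1, smooth (inchart p phi).

(* The group G_{n,k}: generators, acting on homogeneous coordinates,    *)
(* where m.+1 = k * n and block Z_h = (z_{hn}, ..., z_{(h+1)n-1}).      *)
Definition swapnat (i j h : nat) : nat :=
  if h == i then j else if h == j then i else h.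

Definition blockswap {R : realType} {m : nat} (n : nat) (i j : nat)
    (z : hvec R m) : hvec R m :=
  fun p => z (inord (swapnat i j (p %/ n) * n + p %% n)%N).

Definition phaserot {R : realType} {m : nat} (p : 'I_m.+1) (theta : R)
    (z : hvec R m) : hvec R m :=
  fun q => if q == p then (cos theta +i* sin theta) * z q else z q.

Definition transp {R : realType} {m : nat} (p q : 'I_m.+1)
    (z : hvec R m) : hvec R m :=
  fun r => z (if r == p then q else if r == q then p else r).

(* invariance under the generators of G_{n,k} (equivalently, under G_{n,k}) *)
Definition Ginvariant {R : realType} {m : nat} (n k : nat)
    (phi : hvec R m -> R) : Prop :=
  [/\ (forall (i j : 'I_k) z, phi (blockswap n i j z) = phi z),
      (forall p theta z, phi (phaserot p theta z) = phi z) &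
      (forall (p q : 'I_m.+1) z, (p %/ n)%N = (q %/ n)%N ->
          phi (transp p q z) = phi z)].

Definition cabs {R : realType} (c : R[i]) : R := Normc.normc c.

Definition psi {R : realType} {m : nat} (a : R) (z : hvec R m) : \bar R :=
  if [forall p, z p != 0] then
    (ln ((\prod_(p < m.+1) cabs (z p)) `^ (2 * a / m.+1%:R)
         / (\sum_(p < m.+1) cabs (z p) ^+ 2) `^ a))%:E
  else -oo%E.

(* Main.v *)
Require Import Defs.
From HB Require Import structures.
From mathcomp Require Import all_boot all_order all_algebra.
From mathcomp Require Import all_classical all_reals all_analysis.
From mathcomp Require Import complex.
From mathcomp Require Import ring lra.
Set Implicit Arguments.
Unset Strict Implicit.
Unset Printing Implicit Defensive.

Import Order.TTheory GRing.Theory Num.Theory.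
Import numFieldNormedType.Exports.
Local Open Scope ring_scope.
Local Open Scope classical_set_scope.

(** In a chart put [U = phi + a ln (1 + |w|^2)], which is plurisubharmonic, and
    restrict it to the real curves [s |-> (exp (s tau_j))_j].  Torus invariance
    of [U] makes the second derivative along such a curve equal to four times
    the complex Hessian evaluated on the velocity, so [U] is convex along it.

    If all [tau_j <= 0], convexity and the bound [phi <= 0] on the half-line
    [s >= 0] force [U] to be nonincreasing in [s].  In the chart where the
    modulus of the dividing coordinate is maximal this gives [phi <= C] on the
    whole space, with [C = phi [1,...,1] + a ln (m + 1)], hence
    [C >= sup phi = 0].

    Since the group permutes the homogeneous coordinates transitively, all
    logarithmic derivatives of [phi] at [[1,...,1]] are equal; their sum is [0]
    by homogeneity, so each of them vanishes.  The inequality between [phi] and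
    [psi] is then the tangent inequality at [s = 0] along the curve from
    [[1,...,1]] to [[|z_0|,...,|z_m|]]. *)

(** * Convexity in one real variable and chain rules along curves *)

Section calculus.
Variable R : realType.

(** The mean value theorem is used twice: [F1] is monotone since [F2 >= 0], and the chord from [x]
    to [y] has slope [F1 c] at an intermediate [c], which compares with [F1 x]. *)
Lemma is_derive1_tangent_le (F F1 F2 : R -> R) :
  (forall x : R, is_derive x 1 F (F1 x)) ->
  (forall x : R, is_derive x 1 F1 (F2 x)) ->
  (forall x, 0 <= F2 x) -> forall x y, F x + F1 x * (y - x) <= F y.
Proof.
have cont (G G1 : R -> R) (dG : forall x : R, is_derive x 1 G (G1 x)) A :
    {within A, continuous G}.
  apply: continuous_subspaceT => x.
  by apply/differentiable_continuous/derivable1_diffP.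
move=> dF dF1 F2ge0 x y.
have F1_mono u v : u <= v -> F1 u <= F1 v.
  move=> uv; have [c _] := MVT_segment uv (fun z _ => dF1 z) (cont _ _ dF1 _).
  by move=> e; rewrite -subr_ge0 e mulr_ge0 ?subr_ge0.
have [xy|/ltW yx] := leP x y.
- have [c /[!in_itv]/= /andP[xc _] e] := MVT_segment xy (fun z _ => dF z) (cont _ _ dF _).
  by have := ler_wpM2r (eqbRL (subr_ge0 _ _) xy) (F1_mono _ _ xc); lra.
- have [c /[!in_itv]/= /andP[_ cx] e] := MVT_segment yx (fun z _ => dF z) (cont _ _ dF _).
  by have := ler_wpM2r (eqbRL (subr_ge0 _ _) yx) (F1_mono _ _ cx); lra.
Qed.

Lemma is_derive1_comp_curve (V : normedModType R) (U : V -> R) (x : R -> V) (s : R) v :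
  is_derive s 1 x v -> differentiable U (x s) ->
  is_derive s 1 (fun t => U (x t)) ('D_v U (x s)).
Proof.
move=> dx dU; have dxs : differentiable x s by apply/derivable1_diffP.
apply: DeriveDef; first exact/derivable1_diffP/differentiable_comp.
rewrite [LHS]deriveE; last exact: differentiable_comp.
rewrite diff_comp//= [RHS]deriveE//; congr ('d U _ _).
by rewrite -deriveE// derive_val.
Qed.

Lemma is_derive1_scalel (V : normedModType R) (c : R -> R) (v : V) (s : R) dc :
  is_derive s 1 c dc -> is_derive s 1 (fun t => c t *: v) (dc *: v).
Proof.
move=> dcs; have dcs' : differentiable c s by apply/derivable1_diffP.
apply: DeriveDef; first exact/derivable1_diffP/differentiableZl.
by rewrite deriveE ?diffZl -?deriveE ?derive_val//; apply/differentiableZl.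
Qed.

Lemma derive_linear_comb (V : normedModType R) (U : V -> R) n (c : 'I_n -> R)
    (e : 'I_n -> V) x : differentiable U x ->
  'D_(\sum_j c j *: e j) U x = \sum_j c j * 'D_(e j) U x.
Proof.
move=> dU; rewrite deriveE// linear_sum/=.
by apply: eq_bigr => j _; rewrite linearZ/= deriveE.
Qed.

Lemma is_derive_sum_fct (V W : normedModType R) n (h : 'I_n -> V -> W) x v dh :
  (forall i, is_derive x v (h i) (dh i)) ->
  is_derive x v (fun y => \sum_(i < n) h i y) (\sum_(i < n) dh i).
Proof.
move=> H; rewrite (_ : (fun y => _) = \sum_(i < n) h i); first exact: is_derive_sum.
by apply/funext => y; rewrite fct_sumE.
Qed.

Lemma is_derive_expR_scale (c s : R) :
  is_derive s 1 (fun t : R => expR (t * c)) (c * expR (s * c)).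
Proof.
have dl : is_derive s 1 (fun t : R => t * c) c.
  rewrite -[X in is_derive _ _ _ X]mul1r -[1 * _]/(1 *: _).
  exact: (is_derive1_scalel (c := id)).
have := is_derive1_comp_curve (U := expR) dl.
move=> /(_ ((derivable1_diffP _ _).1 (@derivable_expR _ _))) h.
apply: is_derive_eq h _.
by rewrite deriveE ?diff1E ?derive1E ?derive_val//; apply/derivable1_diffP.
Qed.

End calculus.

(** * Rays, rotations of one coordinate, and torus-invariant functions *)

Section torus_invariance.
Variables (R : realType) (m : nat).
Local Notation V := ('rV[R]_m * 'rV[R]_m)%type.
Implicit Types (U : V -> R) (x : V) (j l : 'I_m) (tau : 'I_m -> R).

(** In logarithmic coordinates this is a straight line with direction [tau]; it stays in the
    positive real orthant and meets the all-ones point at [s = 0]. *)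
Definition ray tau (s : R) : V := (\row_j expR (s * tau j), 0).

Definition rot j (theta : R) x : V :=
  (\row_l (if l == j then cos theta * x.1 0 l - sin theta * x.2 0 l else x.1 0 l),
   \row_l (if l == j then sin theta * x.1 0 l + cos theta * x.2 0 l else x.2 0 l)).

Definition torus_invariant U := forall j theta x, U (rot j theta x) = U x.

Lemma rayE tau s : ray tau s = \sum_j expR (s * tau j) *: du j.
Proof.
have fstS : (\sum_j expR (s * tau j) *: du j : V).1 =
    \sum_j expR (s * tau j) *: delta_mx 0 j by rewrite (raddf_sum fst).
have sndS : (\sum_j expR (s * tau j) *: du j : V).2 =
    \sum_(j < m) 0 by rewrite (raddf_sum snd); apply: eq_bigr => j _; rewrite /= scaler0.
rewrite /ray (surjective_pairing (\sum_j _)) fstS sndS big1_eq; congr pair.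
by rewrite [LHS]row_sum_delta; apply: eq_bigr => j _; rewrite mxE.
Qed.

(** In this form [theta] enters only through scalar coefficients of fixed vectors, so the orbit can
    be differentiated with [is_derive1_scalel]. *)
Lemma rotE j theta x : rot j theta x = x
  + ((cos theta - 1) * x.1 0 j - sin theta * x.2 0 j) *: du j
  + (sin theta * x.1 0 j + (cos theta - 1) * x.2 0 j) *: dv j.
Proof.
rewrite /rot /du /dv; congr pair; apply/rowP => l; rewrite !mxE /= eq_sym;
  by case: eqP => [->|_]; rewrite ?mulr0 ?mulr1 ?addr0//; ring.
Qed.

Lemma is_derive_ray tau (s : R) :
  is_derive s 1 (ray tau) (\sum_j (tau j * expR (s * tau j)) *: du j : V).
Proof.
rewrite (_ : ray tau = fun t => \sum_j expR (t * tau j) *: du j); last first.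
  by apply/funext => t; rewrite rayE.
apply: is_derive_sum_fct => j; apply: is_derive1_scalel.
exact: is_derive_expR_scale.
Qed.

Lemma is_derive_along_ray U tau (s : R) : differentiable U (ray tau s) ->
  is_derive s 1 (fun t => U (ray tau t))
    (\sum_j tau j * expR (s * tau j) * 'D_(du j) U (ray tau s)).
Proof.
move=> dU; rewrite -derive_linear_comb//.
exact: is_derive1_comp_curve (is_derive_ray tau s) dU.
Qed.

(** [U] is constant on the orbit of [x] under [rot j], whose velocity at angle [0] is
    [- x.2 0 j *: du j + x.1 0 j *: dv j]. *)
Lemma torus_invariant_derive U j x :
  torus_invariant U -> differentiable U x ->
  x.1 0 j * 'D_(dv j) U x = x.2 0 j * 'D_(du j) U x.
Proof.
move=> iU dU.
pose c (t : R) : R := (cos t - 1) * x.1 0 j - sin t * x.2 0 j.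
pose d (t : R) : R := sin t * x.1 0 j + (cos t - 1) * x.2 0 j.
have dc : is_derive (0 : R) 1 c (- x.2 0 j).
  change c with ((@cos R - cst 1) * cst (x.1 0 j) - @sin R * cst (x.2 0 j)).
  apply: is_derive_eq; rewrite /= cos0 sin0 !scaler0 !add0r oppr0 addr0 scaler0.
  by rewrite add0r [_ *: _]mulr1.
have dd : is_derive (0 : R) 1 d (x.1 0 j).
  change d with (@sin R * cst (x.1 0 j) + (@cos R - cst 1) * cst (x.2 0 j)).
  apply: is_derive_eq; rewrite /= cos0 sin0 !scaler0 !add0r oppr0 addr0 scaler0.
  by rewrite addr0 [_ *: _]mulr1.
have drot : is_derive (0 : R) 1 (fun t => rot j t x)
    (- x.2 0 j *: du j + x.1 0 j *: dv j : V).
  rewrite (_ : (fun _ => _) = cst x + (fun t => c t *: du j) + fun t => d t *: dv j);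
    last by apply/funext => t; rewrite rotE.
  rewrite -[X in is_derive _ _ _ (X + _)]add0r.
  exact: is_deriveD (is_deriveD (is_derive_cst _ _ _) (is_derive1_scalel _ dc))
    (is_derive1_scalel _ dd).
have rot0 : rot j 0 x = x.
  by rewrite rotE cos0 sin0 subrr !mul0r !addr0 subr0 !scale0r !addr0.
have dU0 : differentiable U (rot j 0 x) by rewrite rot0.
have [_] := is_derive1_comp_curve drot dU0.
rewrite (_ : (fun _ => _) = cst (U x)); last by apply/funext => t; exact: iU.
rewrite derive_cst rot0 !deriveE// linearD !linearZ/= => /esym.
by rewrite scaleNr => /eqP; rewrite addrC subr_eq0 => /eqP.
Qed.

End torus_invariance.

(** * Second derivatives along rays and the complex Hessian *)

Section radial_hessian.
Variables (R : realType) (m : nat).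
Local Notation V := ('rV[R]_m * 'rV[R]_m)%type.
Implicit Types (U : V -> R) (x v : V) (j l : 'I_m) (tau : 'I_m -> R).

Lemma is_diff_fst_coord j x :
  is_diff x (fun y : V => y.1 0 j : R) (fun y : V => y.1 0 j).
Proof.
have lin : linear (fun y : V => y.1 0 j : R) by move=> a y z; rewrite /= !mxE.
pose f : {linear V -> R} := HB.pack (fun y : V => y.1 0 j : R)
  (GRing.isLinear.Build _ _ _ _ _ lin).
have cf : continuous f.
  by move=> y; apply: (@cvg_comp _ _ _ fst (fun M : 'rV[R]_m => M 0 j));
    [exact: cvg_fst|exact: coord_continuous].
apply: DiffDef; first exact: (linear_differentiable (f := f)).
exact: (diff_lin (f := f)).
Qed.

Lemma is_diff_snd_coord j x :
  is_diff x (fun y : V => y.2 0 j : R) (fun y : V => y.2 0 j).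
Proof.
have lin : linear (fun y : V => y.2 0 j : R) by move=> a y z; rewrite /= !mxE.
pose f : {linear V -> R} := HB.pack (fun y : V => y.2 0 j : R)
  (GRing.isLinear.Build _ _ _ _ _ lin).
have cf : continuous f.
  by move=> y; apply: (@cvg_comp _ _ _ snd (fun M : 'rV[R]_m => M 0 j));
    [exact: cvg_snd|exact: coord_continuous].
apply: DiffDef; first exact: (linear_differentiable (f := f)).
exact: (diff_lin (f := f)).
Qed.

Lemma is_diff_is_derive (f df : V -> R) x v :
  is_diff x f df -> is_derive x v f (df v).
Proof.
move=> H; apply: DeriveDef; first exact/diff_derivable.
by rewrite deriveE// diff_val.
Qed.

(** The identity of [torus_invariant_derive] is differentiated in direction [dv l]; the mixed second
    derivative carries the factor [x.2 0 j], which is [0] here. *)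
Lemma torus_invariant_d2 U j l x :
  torus_invariant U -> (forall y, differentiable U y) ->
  (forall v y, differentiable ('D_v U) y) -> x.2 = 0 ->
  x.1 0 j * d2 (dv l) (dv j) U x = (l == j)%:R * 'D_(du j) U x.
Proof.
move=> iU dU ddU x0; rewrite /d2.
have e : (fun y : V => y.1 0 j) * 'D_(dv j) U = (fun y : V => y.2 0 j) * 'D_(du j) U.
  by apply/funext => y; exact: torus_invariant_derive.
have d1 := is_diff_is_derive (dv l) (is_diff_fst_coord j x).
have d2 := is_diff_is_derive (dv l) (is_diff_snd_coord j x).
have dd (w : V) : is_derive x (dv l) ('D_w U) ('D_(dv l) ('D_w U) x).
  exact/derivableP/diff_derivable.
have [_ E1] := is_deriveM d1 (dd (dv j)).
have [_ E2] := is_deriveM d2 (dd (du j)).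
have : x.1 0 j * 'D_(dv l) ('D_(dv j) U) x + 'D_(dv j) U x * (dv l : V).1 0 j =
       x.2 0 j * 'D_(dv l) ('D_(du j) U) x + 'D_(du j) U x * (dv l : V).2 0 j.
  by rewrite e in E1; exact: etrans (esym E1) E2.
have -> : (dv l : V).1 0 j = 0 by rewrite mxE.
have -> : (dv l : V).2 0 j = (l == j)%:R by rewrite mxE eqxx eq_sym.
have -> : x.2 0 j = 0 by rewrite x0 mxE.
have alg (A B C D p q : R) : p * A + C * 0 = 0 * B + D * q -> p * A = q * D.
  by rewrite mulr0 addr0 mul0r add0r => ->; rewrite mulrC.
exact: alg.
Qed.

(** Four times the real part of the complex Hessian form of [U] on the velocity of the ray, a vector
    with real entries [tau l * expR (s * tau l)]. *)
Definition ray_hess U tau (s : R) : R :=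
  \sum_l \sum_j (tau l * expR (s * tau l)) * (tau j * expR (s * tau j)) *
    (d2 (du l) (du j) U (ray tau s) + d2 (dv l) (dv j) U (ray tau s)).

(** The product rule gives the [du]-[du] terms and a diagonal term in ['D_(du j) U];
    [torus_invariant_d2] turns the latter into the [dv]-[dv] terms. *)
Lemma is_derive2_along_ray U tau (s : R) :
  torus_invariant U -> (forall y, differentiable U y) ->
  (forall v y, differentiable ('D_v U) y) ->
  is_derive s 1 (fun t => \sum_j tau j * expR (t * tau j) * 'D_(du j) U (ray tau t))
    (ray_hess U tau s).
Proof.
move=> iU dU ddU.
(* Here [c] is [tau], [e] the coordinates on the ray, [A] and [B] the [du]-[du] and [dv]-[dv]
   derivatives, and [D] is ['D_(du j) U]. *)
have alg j (c e A B : 'I_m -> R) (D : R) :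
    (forall l, e j * B l = (l == j)%:R * D) ->
    c j * e j * (\sum_l c l * e l * A l) + D * (c j * (c j * e j)) =
    \sum_l c l * e l * (c j * e j) * (A l + B l).
  move=> h; under [RHS]eq_bigr do rewrite mulrDr.
  rewrite big_split /= mulr_sumr; congr (_ + _).
    by apply: eq_bigr => l _; ring.
  rewrite (bigD1 j)//= big1 ?addr0 => [|l lj].
    by have := h j; rewrite eqxx mul1r => <-; ring.
  by rewrite -mulrA -(mulrA (c j)) h (negPf lj) mul0r !mulr0.
rewrite /ray_hess exchange_big /=; apply: is_derive_sum_fct => j.
have d1 := is_derive_along_ray (ddU (du j) (ray tau s)).
have d0 := is_derive_expR_scale (tau j) s.
have /is_derive_eq := is_deriveM (is_deriveZ (tau j) d0) d1.
apply; apply: (alg j tau (fun l => expR (s * tau l))) => l.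
have := torus_invariant_d2 j l iU dU ddU (erefl : (ray tau s).2 = 0).
by rewrite mxE.
Qed.

Lemma Re_hermitian_real (H : 'M[R[i]]_m) (c : 'I_m -> R)
    (xi := \col_l (c l)%:C%C : 'cV[R[i]]_m) :
  complex.Re (\sum_l \sum_mu H l mu * xi l 0 * (xi mu 0)^*%C) =
  \sum_l \sum_mu c l * c mu * complex.Re (H l mu).
Proof.
rewrite (raddf_sum (@complex.Re R)); apply: eq_bigr => l _.
rewrite (raddf_sum (@complex.Re R)); apply: eq_bigr => j _.
by rewrite !mxE; case: (H l j) => p q /=; ring.
Qed.

Lemma Re_cHess U x l j :
  4%:R * complex.Re (cHess U x l j) = d2 (du l) (du j) U x + d2 (dv l) (dv j) U x.
Proof. by rewrite mxE /= mulrC divfK. Qed.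

Lemma posdef_ray_hess U1 U2 tau (s : R) :
  posdef (cHess U1 (ray tau s) + cHess U2 (ray tau s)) ->
  0 <= ray_hess U1 tau s + ray_hess U2 tau s.
Proof.
pose c l := tau l * expR (s * tau l).
pose H := cHess U1 (ray tau s) + cHess U2 (ray tau s).
have -> : ray_hess U1 tau s + ray_hess U2 tau s =
    4%:R * \sum_l \sum_j c l * c j * complex.Re (H l j).
  rewrite /ray_hess -big_split mulr_sumr; apply: eq_bigr => l _.
  rewrite -big_split mulr_sumr; apply: eq_bigr => j _.
  have -> : complex.Re (H l j) =
      complex.Re (cHess U1 (ray tau s) l j) + complex.Re (cHess U2 (ray tau s) l j).
    by rewrite mxE raddfD.
  have alg (p A1 A2 h1 h2 : R) : 4%:R * h1 = A1 -> 4%:R * h2 = A2 ->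
    p * A1 + p * A2 = 4%:R * (p * (h1 + h2)) by move=> <- <-; ring.
  exact: alg (Re_cHess _ _ _ _) (Re_cHess _ _ _ _).
rewrite -/H; move: H => H Hpos; rewrite pmulr_rge0 //.
pose xi : 'cV[R[i]]_m := \col_l (c l)%:C%C.
(* The velocity may be zero, where positive definiteness is silent; the sum then vanishes term by
   term. *)
have [xi0|/Hpos] := eqVneq xi 0.
  have c0 l : c l = 0 by have /colP/(_ l) := xi0; rewrite !mxE => -[].
  by rewrite big1 // => l _; rewrite big1 // => j _; rewrite c0 !mul0r.
by rewrite ltcE Re_hermitian_real => /andP[_ /ltW].
Qed.

End radial_hessian.

(** * The Fubini-Study potential in a chart *)

Section fubini_study_potential.
Variables (R : realType) (m : nat).
Local Notation V := ('rV[R]_m * 'rV[R]_m)%type.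
Implicit Types (U : V -> R) (x v : V) (j l : 'I_m) (tau : 'I_m -> R).

Definition one_norm2 x : R := 1 + \sum_j (x.1 0 j ^+ 2 + x.2 0 j ^+ 2).

Lemma one_norm2_ge1 x : 1 <= one_norm2 x.
Proof. by rewrite lerDl sumr_ge0 // => j _; rewrite addr_ge0 ?sqr_ge0. Qed.

Lemma one_norm2_gt0 x : 0 < one_norm2 x.
Proof. exact: lt_le_trans ltr01 (one_norm2_ge1 x). Qed.

Lemma one_norm2E : one_norm2 = cst 1 + \sum_j
  ((fun y : V => y.1 0 j : R) * (fun y : V => y.1 0 j : R) +
   (fun y : V => y.2 0 j : R) * (fun y : V => y.2 0 j : R)).
Proof. by apply/funext => x; rewrite /one_norm2 !fctE fct_sumE. Qed.

Lemma differentiable_fst_coord j x : differentiable (fun y : V => y.1 0 j : R) x.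
Proof. by have := is_diff_fst_coord j x. Qed.

Lemma differentiable_snd_coord j x : differentiable (fun y : V => y.2 0 j : R) x.
Proof. by have := is_diff_snd_coord j x. Qed.

Lemma differentiable_one_norm2 x : differentiable one_norm2 x.
Proof.
rewrite one_norm2E; apply: differentiableD; first exact: differentiable_cst.
apply: differentiable_sum => j; apply: differentiableD; apply: differentiableM;
  by [exact: differentiable_fst_coord|exact: differentiable_snd_coord].
Qed.

Lemma is_derive_one_norm2 x v : is_derive x v one_norm2
  (2%:R * \sum_j (x.1 0 j * v.1 0 j + x.2 0 j * v.2 0 j)).
Proof.
have alg (p q r t : R) :
  p * q + p * q + (r * t + r * t) = 2%:R * (p * q + r * t) by ring.
have D j : is_derive x v ((fun y : V => y.1 0 j : R) * (fun y : V => y.1 0 j : R) +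
    (fun y : V => y.2 0 j : R) * (fun y : V => y.2 0 j : R))
    (2%:R * (x.1 0 j * v.1 0 j + x.2 0 j * v.2 0 j)).
  have d1 := is_diff_is_derive v (is_diff_fst_coord j x).
  have d2 := is_diff_is_derive v (is_diff_snd_coord j x).
  have := is_deriveD (is_deriveM d1 d1) (is_deriveM d2 d2).
  by move/is_derive_eq; apply; exact: alg.
have := is_deriveD (is_derive_cst (1 : R) x v) (is_derive_sum D).
by rewrite one_norm2E mulr_sumr add0r.
Qed.

Lemma derive_ln_comp (q : V -> R) x v dq : 0 < q x -> differentiable q x ->
  is_derive x v q dq -> is_derive x v (fun y => ln (q y)) (dq / q x).
Proof.
move=> q0 diffq dqx.
have dln : is_derive (q x) 1 (@ln R) (q x)^-1 by exact: is_derive1_ln.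
have difln : differentiable (@ln R) (q x) by apply/derivable1_diffP.
have dcomp : differentiable (@ln R \o q) x by exact: differentiable_comp.
apply: DeriveDef; first exact: diff_derivable.
rewrite [LHS](deriveE _ dcomp) diff_comp//= diff1E// derive1E derive_val.
by rewrite -deriveE// derive_val.
Qed.

Lemma differentiable_fs_pot x : differentiable (@fs_pot R m) x.
Proof.
apply: (@differentiable_comp _ _ _ _ one_norm2 (@ln R)).
  exact: differentiable_one_norm2.
apply/derivable1_diffP.
by have [] := is_derive1_ln (one_norm2_gt0 x).
Qed.

Lemma derive_fs_pot x v : 'D_v (@fs_pot R m) x =
  2%:R * (\sum_j (x.1 0 j * v.1 0 j + x.2 0 j * v.2 0 j)) / one_norm2 x.
Proof.
have [_] := derive_ln_comp (one_norm2_gt0 x) (differentiable_one_norm2 x)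
  (is_derive_one_norm2 x v).
exact.
Qed.

Lemma differentiable_derive_fs_pot v x : differentiable ('D_v (@fs_pot R m)) x.
Proof.
(* The derivative is a linear form in the coordinates divided by the positive function
   [one_norm2]. *)
rewrite (_ : 'D_v _ = (2%:R *: \sum_j
    (v.1 0 j *: (fun y : V => y.1 0 j : R) + v.2 0 j *: (fun y : V => y.2 0 j : R)))
    * (fun y => (one_norm2 y)^-1)); last first.
  apply/funext => y; rewrite derive_fs_pot !fctE fct_sumE; congr (_ * _ * _).
  by apply: eq_bigr => j _; rewrite !fctE; congr (_ + _); exact: mulrC.
apply: differentiableM; last first.
  by apply: differentiableV; [exact: differentiable_one_norm2|rewrite gt_eqF ?one_norm2_gt0].
apply: differentiableZ; apply: differentiable_sum => j.
by apply: differentiableD; apply: differentiableZ;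
  [exact: differentiable_fst_coord|exact: differentiable_snd_coord].
Qed.

Lemma torus_invariant_fs_pot : torus_invariant (@fs_pot R m).
Proof.
move=> j theta x; rewrite /fs_pot; congr (ln (1 + _)).
apply: eq_bigr => l _; rewrite !mxE; case: ifP => // _.
move: (x.1 0 l) (x.2 0 l) => p q.
transitivity ((cos theta ^+ 2 + sin theta ^+ 2) * (p ^+ 2 + q ^+ 2)); first by ring.
by rewrite cos2Dsin2 mul1r.
Qed.

End fubini_study_potential.

(** * Convexity along rays *)

Section ray_convexity.
Variables (R : realType) (m : nat).
Local Notation V := ('rV[R]_m * 'rV[R]_m)%type.

(** The potential and [U] remain separate summands because [admissible] adds their Hessians: the ray
    formulas hold for each, and the sign is known for the sum. *)
Lemma psh_ray_tangent (U : V -> R) (a : R) (tau : 'I_m -> R) :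
  torus_invariant U -> (forall y, differentiable U y) ->
  (forall v y, differentiable ('D_v U) y) ->
  (forall x, posdef (cHess (fun y => a * fs_pot y) x + cHess U x)) ->
  forall s t : R,
  a * fs_pot (ray tau s) + U (ray tau s) +
  (\sum_j tau j * expR (s * tau j) *
     (a * 'D_(du j) (@fs_pot R m) (ray tau s) + 'D_(du j) U (ray tau s))) * (t - s)
  <= a * fs_pot (ray tau t) + U (ray tau t).
Proof.
move=> iU dU ddU pU s t.
pose P : V -> R := fun y => a * fs_pot y.
have PE : P = a *: (@fs_pot R m) by [].
have dP y : differentiable P y.
  by rewrite PE; apply: differentiableZ; exact: differentiable_fs_pot.
have DP v y : 'D_v P y = a * 'D_v (@fs_pot R m) y.
  by rewrite PE deriveZ //; exact/diff_derivable/differentiable_fs_pot.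
have ddP v y : differentiable ('D_v P) y.
  rewrite (_ : 'D_v P = a *: 'D_v (@fs_pot R m)); last exact/funext/DP.
  by apply: differentiableZ; exact: differentiable_derive_fs_pot.
have iP : torus_invariant P by move=> j th y; rewrite /P torus_invariant_fs_pot.
have D1 (r : R) := is_deriveD (is_derive_along_ray (dP (ray tau r)))
                        (is_derive_along_ray (dU (ray tau r))).
have D2 (r : R) := is_deriveD (is_derive2_along_ray tau r iP dP ddP)
                        (is_derive2_along_ray tau r iU dU ddU).
have H r : 0 <= ray_hess P tau r + ray_hess U tau r by exact/posdef_ray_hess/pU.
have <- : \sum_j tau j * expR (s * tau j) * 'D_(du j) P (ray tau s) +
    \sum_j tau j * expR (s * tau j) * 'D_(du j) U (ray tau s) =
    \sum_j tau j * expR (s * tau j) *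
     (a * 'D_(du j) (@fs_pot R m) (ray tau s) + 'D_(du j) U (ray tau s)).
  by rewrite -big_split; apply: eq_bigr => j _; rewrite DP mulrDr.
exact: is_derive1_tangent_le D1 D2 H s t.
Qed.

End ray_convexity.

(** * Functions on projective space read in the standard charts *)

Section projective.
Variables (R : realType) (m : nat) (phi : hvec R m -> R).
Local Notation V := ('rV[R]_m * 'rV[R]_m)%type.
Local Open Scope complex_scope.
Implicit Types (p q r : 'I_m.+1) (j l : 'I_m) (z : hvec R m).

Hypothesis phi_homog : homog0 phi.
Hypothesis phi_smooth : smoothP phi.
Hypothesis phi_phase : forall p theta z, phi (phaserot p theta z) = phi z.

Lemma unit_circle_angle (x y : R) : x ^+ 2 + y ^+ 2 = 1 ->
  exists theta : R, cos theta = x /\ sin theta = y.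
Proof.
move=> xy1; have x1 : -1 <= x <= 1.
  by rewrite -ler_norml -(@ler_sqr _ `|x|) ?nnegrE// expr1n real_normK ?num_real//
     -xy1 lerDl sqr_ge0.
have yE : Num.sqrt (1 - x ^+ 2) = `|y| by rewrite -xy1 addrC addKr sqrtr_sqr.
have [y0|/ltW y0] := leP 0 y.
  exists (acos x); rewrite acosK ?in_itv// sin_acos// yE ger0_norm//.
exists (- acos x); rewrite cosN sinN acosK ?in_itv// sin_acos// yE ler0_norm//.
by rewrite opprK.
Qed.

Lemma cabs_ge0 (c : R[i]) : 0 <= cabs c.
Proof. by rewrite -lecR -[(cabs c)%:C]/`|c| normr_ge0. Qed.

Lemma cabs_gt0 (c : R[i]) : c != 0 -> 0 < cabs c.
Proof. by move=> c0; rewrite -ltcR -[(cabs c)%:C]/`|c| normr_gt0. Qed.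

Lemma rotate_to_modulus (c : R[i]) :
  exists theta : R, (cos theta +i* sin theta) * c = (cabs c)%:C.
Proof.
case: c => x y; rewrite /cabs /=; set N := Num.sqrt _.
have N2 : N ^+ 2 = x ^+ 2 + y ^+ 2 by rewrite sqr_sqrtr// addr_ge0 ?sqr_ge0.
(* For [c = 0] any angle works; otherwise the rotation is by the conjugate of [c] divided by its
   modulus. *)
have [N0|N0] := eqVneq N 0.
  exists 0; move/esym/eqP: N2; rewrite N0 expr0n /= paddr_eq0 ?sqr_ge0//.
  by rewrite !sqrf_eq0 => /andP[/eqP-> /eqP->]; rewrite mulr0.
have [|theta [ct st]] := @unit_circle_angle (x / N) (- y / N).
  by rewrite !expr_div_n sqrrN -mulrDl -N2 divff// sqrf_eq0.
exists theta; rewrite ct st; apply/eqP; rewrite eq_complex /=; apply/andP; split.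
  apply/eqP; transitivity (N ^+ 2 / N); first by rewrite N2; field.
  by field.
by apply/eqP; field.
Qed.

(** Coordinates are rotated onto their moduli one at a time; the list [s] records those already
    treated. *)
Lemma phi_modulus z : phi z = phi (fun q => (cabs (z q))%:C).
Proof.
have H (s : seq 'I_m.+1) :
    phi (fun q => if q \in s then (cabs (z q))%:C else z q) = phi z.
  elim: s => [|p s IH]; first by congr phi.
  have [ps|ps] := boolP (p \in s).
    rewrite -[RHS]IH; congr phi; apply/funext => q; rewrite inE.
    by case: eqP => [->|//]; rewrite ps.
  have [theta e] := rotate_to_modulus (z p).
  rewrite -[RHS]IH -[RHS](phi_phase p theta); congr phi; apply/funext => q.
  by rewrite /phaserot inE; case: eqP => [->|//]; rewrite (negPf ps) /= e.
rewrite -(H (enum 'I_m.+1)); congr phi; apply/funext => q.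
by rewrite mem_enum.
Qed.

Lemma torus_invariant_inchart p : torus_invariant (inchart p phi).
Proof.
move=> j theta x; rewrite /inchart -[RHS](phi_phase (lift p j) theta).
congr phi; apply/funext => q; rewrite /chart /phaserot.
case: unliftP => [l ->|->]; last by rewrite eq_liftF.
rewrite !mxE (inj_eq (@lift_inj _ p)); case: eqP => [->|//].
apply/eqP; rewrite eq_complex /=; apply/andP; split; apply/eqP => //; ring.
Qed.

Lemma differentiable_inchart p x : differentiable (inchart p phi) x.
Proof. by have [] := phi_smooth p 1%N. Qed.

Lemma differentiable_derive_inchart p v x :
  differentiable ('D_v (inchart p phi)) x.
Proof. by have [_ /(_ v) []] := phi_smooth p 2%N. Qed.

Lemma phi_inchart p (c : 'I_m.+1 -> R) : 0 < c p ->
  phi (fun q => (c q)%:C) = inchart p phi (\row_j (c (lift p j) / c p), 0).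
Proof.
move=> cp; have cp0 : (c p)%:C != 0 by rewrite eq_complex /= negb_and gt_eqF.
rewrite /inchart -[RHS](phi_homog _ cp0); congr phi; apply/funext => q.
rewrite /chart; case: unliftP => [l ->|->]; last by rewrite mulr1.
by rewrite /= !mxE -rmorphM /= mulrC divfK ?gt_eqF//.
Qed.

Lemma inchart_one p : inchart p phi (const_mx 1, 0) = phi (fun=> 1).
Proof.
congr phi; apply/funext => q; rewrite /chart; case: unliftP => [l _|//].
by rewrite !mxE.
Qed.

(** Dividing by the coordinate of index [p] subtracts [t p] from the exponents. *)
Lemma inchart_ray (t : 'I_m.+1 -> R) p (s : R) :
  inchart p phi (ray (fun j => t (lift p j) - t p) s) =
  phi (fun q => (expR (s * t q))%:C).
Proof.
rewrite (phi_inchart (p := p)) ?expR_gt0//; congr (inchart p phi (_, _)).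
by apply/rowP => j; rewrite !mxE mulrBr expRD expRN.
Qed.

Lemma ray0 (tau : 'I_m -> R) : ray tau 0 = (const_mx 1, 0).
Proof. by congr pair; apply/rowP => j; rewrite !mxE mul0r expR0. Qed.

(** The second condition makes reindexing by [sigma] turn the indicator of [q] into that of [p]. *)
Definition coord_transitive := forall p q, exists2 sigma : 'I_m.+1 -> 'I_m.+1,
  (forall z, phi (fun r => z (sigma r)) = phi z) &
  (forall r, (sigma r == q) = (r == p)).

Lemma derive_inchart_one0 p j : coord_transitive ->
  'D_(du j) (inchart p phi) (const_mx 1, 0) = 0.
Proof.
move=> trans.
pose c l := 'D_(du l) (inchart p phi) (const_mx 1, 0).
(* The logarithmic derivative of [phi] at [[1,...,1]] in direction [t]. *)
pose D (t : 'I_m.+1 -> R) : R :=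
  'D_1 (fun s : R => phi (fun q => (expR (s * t q))%:C)) (0 : R).
have DE t : D t = \sum_l (t (lift p l) - t p) * c l.
  have := is_derive_along_ray (tau := fun j => t (lift p j) - t p) (s := 0)
            (differentiable_inchart p _).
  move=> [_]; rewrite /D; under eq_fun do rewrite inchart_ray.
  by move=> ->; apply: eq_bigr => l _; rewrite mul0r expR0 mulr1 ray0.
pose d q := D (fun r => (r == q)%:R).
have deq q q' : d q = d q'.
  have [sigma phis sE] := trans q q'.
  apply: (congr1 (fun f : R -> R => 'D_1 f (0 : R))); apply/funext => s.
  by rewrite -[RHS]phis; congr phi; apply/funext => r; rewrite sE.
(* The indicators add up to the constant direction, along which all differences [t (lift p l) - t p]
   vanish. *)
have dsum : \sum_q d q = 0.
  under eq_bigr do rewrite /d DE.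
  rewrite exchange_big big1 // => l _; rewrite -mulr_suml sumrB.
  have one r : \sum_(i < m.+1) ((r == i)%:R : R) = 1.
    rewrite (bigD1 r)//= eqxx big1 ?addr0 // => i.
    by rewrite eq_sym => /negPf->.
  by rewrite !one subrr mul0r.
have d0 q : d q = 0.
  have : \sum_(q' < m.+1) d q = 0 by rewrite -[RHS]dsum; apply: eq_bigr => i _.
  rewrite sumr_const card_ord => /eqP; rewrite mulrn_eq0 => /orP[//|/eqP//].
(* For the indicator of [lift p j], only the term [l = j] of [DE] survives, with coefficient [1]. *)
rewrite -/(c j) -[RHS](d0 (lift p j)) /d DE (bigD1 j)//= eqxx eq_liftF subr0 mul1r.
rewrite big1 ?addr0 // => l lj.
by rewrite (inj_eq (@lift_inj _ p)) (negPf lj) subr0 mul0r.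
Qed.

(** * Global upper bound and tangent inequality for admissible functions *)

Section admissible.
Variable a : R.
Hypothesis a_gt0 : 0 < a.
Hypothesis phi_adm : admissible a phi.

Lemma inchart_ray_tangent p (tau : 'I_m -> R) (s t : R) :
  a * fs_pot (ray tau s) + inchart p phi (ray tau s) +
  (\sum_j tau j * expR (s * tau j) *
     (a * 'D_(du j) (@fs_pot R m) (ray tau s) +
      'D_(du j) (inchart p phi) (ray tau s))) * (t - s)
  <= a * fs_pot (ray tau t) + inchart p phi (ray tau t).
Proof.
apply: psh_ray_tangent; [exact: torus_invariant_inchart|
  exact: differentiable_inchart|exact: differentiable_derive_inchart|exact: phi_adm].
Qed.

Lemma fs_pot_ge0 (x : V) : 0 <= fs_pot x.
Proof. by rewrite ln_ge0 // one_norm2_ge1. Qed.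

Lemma fs_pot_ray (tau : 'I_m -> R) (s : R) :
  fs_pot (ray tau s) = ln (1 + \sum_j expR (s * tau j) ^+ 2).
Proof.
by congr (ln (1 + _)); apply: eq_bigr => j _; rewrite !mxE expr0n addr0.
Qed.

Lemma fs_pot_ray0 (tau : 'I_m -> R) : fs_pot (ray tau 0) = ln m.+1%:R.
Proof.
rewrite fs_pot_ray -[m.+1]add1n natrD; congr (ln (_ + _)).
under eq_bigr do rewrite mul0r expR0 expr1n.
by rewrite sumr_const card_ord.
Qed.

Lemma fs_pot_ray_le (tau : 'I_m -> R) (s : R) :
  (forall j, tau j <= 0) -> 0 <= s -> fs_pot (ray tau s) <= ln m.+1%:R.
Proof.
move=> tau0 s0; rewrite fs_pot_ray ler_ln ?posrE; last 2 first.
- by rewrite ltr_wpDr ?ltr01 ?sumr_ge0 // => j _; rewrite sqr_ge0.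
- by [].
rewrite -[m.+1]add1n natrD lerD2l.
rewrite -[X in X%:R]card_ord -sumr_const ler_sum // => j _.
by rewrite expr_le1 ?expR_ge0// -expR0 ler_expR mulr_ge0_le0.
Qed.

Hypothesis phi_le0 : forall z, hnonzero z -> phi z <= 0.

Lemma hnonzero_chart p (x : V) : hnonzero (chart p x).
Proof. by exists p; rewrite /chart unlift_none oner_neq0. Qed.

(* A convex function that is bounded above on a half-line is monotone there. *)
Lemma inchart_ray_le_one p (tau : 'I_m -> R) : (forall j, tau j <= 0) ->
  inchart p phi (ray tau 1) <= phi (fun=> 1) + a * ln m.+1%:R.
Proof.
move=> tau0; have := inchart_ray_tangent p tau 1; set F1 := (_ + inchart p phi _).
set S := \sum_j _ => tgt.
have bound (t : R) : 1 <= t -> F1 + S * (t - 1) <= a * ln m.+1%:R.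
  move=> t1; apply: le_trans (tgt t) _; rewrite -[leRHS]addr0 lerD//.
    by rewrite ler_pM2l// fs_pot_ray_le// (le_trans ler01).
  by apply: phi_le0; exact: hnonzero_chart.
have S0 : S <= 0.
  rewrite leNgt; apply/negP => S0.
  (* Chosen so that the tangent line, at [t], exceeds the upper bound [a * ln m.+1%:R] by at least
     [1]. *)
  pose t := 1 + (`|a * ln m.+1%:R - F1| + 1) / S.
  have t1 : 1 <= t by rewrite lerDl divr_ge0 ?addr_ge0// ltW.
  have St : S * (t - 1) = `|a * ln m.+1%:R - F1| + 1.
    by rewrite /t addrC addKr mulrC divfK ?gt_eqF.
  have := bound t t1; rewrite St.
  by have := ler_norm (a * ln m.+1%:R - F1); lra.
have := tgt 0; rewrite sub0r mulrN1 fs_pot_ray0 ray0 inchart_one /F1.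
by have := mulr_ge0 (ltW a_gt0) (fs_pot_ge0 (ray tau 1)); lra.
Qed.

(** A point with a zero coordinate lies on no ray, so the bound is carried to it by continuity. *)
Lemma inchart_le_one p (w : 'rV[R]_m) : (forall j, 0 <= w 0 j <= 1) ->
  inchart p phi (w, 0) <= phi (fun=> 1) + a * ln m.+1%:R.
Proof.
move=> w01; set C := (_ + _).
(* Moving towards the all-ones point puts every coordinate in []0, 1]] for [0 < e <= 1]; the
   logarithms are then nonpositive exponents of a ray. *)
pose x (e : R) : V := ((w, 0) : V) + e *: ((const_mx 1 - w, 0) : V).
have pos (e : R) : 0 < e <= 1 -> inchart p phi (x e) <= C.
  move=> /andP[e0 e1].
  have xp j : 0 < (x e).1 0 j <= 1.
    by rewrite !mxE; have /andP[w0 w1] := w01 j; apply/andP; split; nra.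
  suff -> : x e = ray (fun j => ln ((x e).1 0 j)) 1.
    by apply: inchart_ray_le_one => j; have /andP[? ?] := xp j; rewrite ln_le0.
  rewrite [LHS]surjective_pairing; congr pair.
    by apply/rowP => j; rewrite [RHS]mxE mul1r lnK // posrE; have /andP[] := xp j.
  by rewrite /= scaler0 addr0.
have cx : {for (0 : R), continuous (fun e => inchart p phi (x e))}.
  apply: (@continuous_comp _ _ _ x); last first.
    exact/differentiable_continuous/differentiable_inchart.
  apply: cvgD; first exact: cvg_cst.
  by apply: cvgZr_tmp; exact: cvg_id.
have x0 : x 0 = (w, 0) by rewrite /x scale0r addr0.
rewrite -x0 leNgt; apply/negP => Clt.
have [e /= e0 He] : exists2 e : R, 0 < e & forall t : R, `|t| < e -> C < inchart p phi (x t).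
  have /cvgr_gt/(_ _ Clt)/nbhs_norm0P[e /= e0 He] := cx.
  by exists e => // t te; exact: He.
(* Small enough both for [pos] and for the neighbourhood of radius [e]. *)
pose t := Num.min 1 (e / 2).
have t0 : 0 < t by rewrite lt_min ltr01 divr_gt0.
have te : `|t| < e.
  by rewrite gtr0_norm// /t gt_min [e / 2 < e]ltr_pdivrMr// ltr_pMr// ltr1n orbT.
by have := He t te; rewrite ltNge pos // t0 /t ge_min lexx.
Qed.

Lemma phi_le_one z : hnonzero z -> phi z <= phi (fun=> 1) + a * ln m.+1%:R.
Proof.
move=> [p0 zp0]; rewrite phi_modulus.
have [p _ pmax] := @Order.TotalTheory.arg_maxP _ _ _ p0 predT (fun q => cabs (z q)) isT.
have cp : 0 < cabs (z p) by exact: lt_le_trans (cabs_gt0 zp0) (pmax p0 isT).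
rewrite (phi_inchart (c := fun q => cabs (z q)) (p := p)) //.
apply: inchart_le_one => j; rewrite mxE divr_ge0 ?cabs_ge0 //=.
by rewrite ler_pdivrMr// mul1r; exact: pmax.
Qed.

Lemma one_norm2_one : one_norm2 ((const_mx 1, 0) : V) = m.+1%:R.
Proof.
rewrite /one_norm2; under eq_bigr do rewrite !mxE expr1n expr0n addr0.
by rewrite sumr_const card_ord -natr1 addrC.
Qed.

Lemma derive_fs_pot_one j :
  'D_(du j) (@fs_pot R m) (const_mx 1, 0) = 2%:R / m.+1%:R.
Proof.
rewrite derive_fs_pot one_norm2_one; congr (_ / _); rewrite -[RHS]mulr1; congr (_ * _).
rewrite (bigD1 j)//= big1 ?addr0 => [|l lj]; rewrite !mxE ?eqxx ?(negPf lj) /=.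
  by rewrite mulr1 mulr0 addr0.
by rewrite !mulr0 addr0.
Qed.

(** The left side is [psi] with its logarithm expanded. The tangent at [0] is evaluated at [1] on
    the ray with exponents [ln (cabs (z q))]; only the potential contributes to its slope. *)
Lemma log_monomial_le_phi z : coord_transitive ->
  0 <= phi (fun=> 1) + a * ln m.+1%:R -> (forall p, z p != 0) ->
  2%:R * a / m.+1%:R * (\sum_q ln (cabs (z q))) - a * ln (\sum_q cabs (z q) ^+ 2)
  <= phi z.
Proof.
move=> trans phi1 z0; pose t q := ln (cabs (z q)).
have tE q : cabs (z q) = expR (t q) by rewrite lnK // posrE cabs_gt0.
pose tau j := t (lift ord0 j) - t ord0.
have := inchart_ray_tangent ord0 tau 0 1.
rewrite subr0 mulr1 (inchart_ray t ord0 1) fs_pot_ray0 ray0 inchart_one.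
have -> : phi (fun q => (expR (1 * t q))%:C) = phi z.
  by rewrite [RHS]phi_modulus; congr phi; apply/funext => q; rewrite mul1r tE.
(* The [m] differences [tau j] add up to [\sum_q t q - m.+1%:R * t ord0], whence the last term. *)
have -> : \sum_j tau j * expR (0 * tau j) *
     (a * 'D_(du j) (@fs_pot R m) (const_mx 1, 0) +
      'D_(du j) (inchart ord0 phi) (const_mx 1, 0)) =
    2%:R * a / m.+1%:R * (\sum_q t q) - 2%:R * a * t ord0.
  transitivity (\sum_j tau j * (2%:R * a / m.+1%:R)).
    apply: eq_bigr => j _; rewrite derive_inchart_one0 // derive_fs_pot_one.
    by rewrite mul0r expR0 mulr1 addr0; congr (_ * _); rewrite mulrCA mulrA.
  rewrite -mulr_suml sumrB sumr_const card_ord big_ord_recl -mulr_natr.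
  have m0 : m.+1%:R != 0 :> R by rewrite pnatr_eq0.
  have mE : m.+1%:R = m%:R + 1 :> R by rewrite natr1.
  by move: m0; rewrite mE => m0; field.
(* The factor [cabs (z ord0) ^+ 2] is taken out of the squared norm. *)
have -> : ln (\sum_q cabs (z q) ^+ 2) = 2%:R * t ord0 + fs_pot (ray tau 1).
  rewrite fs_pot_ray; transitivity (ln (expR (2%:R * t ord0) *
     (1 + \sum_j expR (1 * tau j) ^+ 2))).
    congr ln; rewrite big_ord_recl mulrDr mulr1 mulr_sumr; congr (_ + _).
      by rewrite tE -expRM_natl.
    apply: eq_bigr => j _; rewrite tE -!expRM_natl -expRD; congr expR.
    by rewrite /tau; ring.
  rewrite lnM ?posrE ?expR_gt0 ?expRK//.
  by rewrite ltr_wpDr ?ltr01 ?sumr_ge0 // => j _; rewrite sqr_ge0.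
(* The two multiples of [t ord0] cancel, and the constant left over is nonnegative by [phi1]. *)
rewrite mulrDr mulrCA; move: phi1; rewrite -/t.
move: (2%:R * a / _ * _) (fs_pot _) (phi z) (phi _) (ln m.+1%:R) => A B C D E.
lra.
Qed.

End admissible.

End projective.

(** * Transitivity of the group on the homogeneous coordinates *)

Section group_transitivity.
Variables (R : realType) (k n : nat).
Hypotheses (k_gt0 : (1 <= k)%N) (n_gt0 : (1 <= n)%N).
Local Notation m := (k * n).-1.

Lemma size_prednK : m.+1 = (k * n)%N.
Proof. by rewrite prednK // muln_gt0 k_gt0. Qed.

Lemma block_lt (p : 'I_m.+1) : (p %/ n < k)%N.
Proof. by rewrite ltn_divLR //; apply: (leq_trans (ltn_ord p)); rewrite size_prednK. Qed.

Lemma swapnatK i j : involutive (swapnat i j).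
Proof.
move=> h; rewrite /swapnat; case: (eqVneq h i) => [->|hi].
  by rewrite eqxx; case: eqP.
by case: (eqVneq h j) => [->|/negPf hj]; rewrite ?eqxx // (negPf hi) hj.
Qed.

Definition blockswap_idx (i j : 'I_k) (r : 'I_m.+1) : 'I_m.+1 :=
  inord (swapnat i j (r %/ n) * n + r %% n).

(** The computed index stays below [k * n], so [inord] never returns its default value. *)
Lemma blockswap_idxE (i j : 'I_k) (r : 'I_m.+1) :
  blockswap_idx i j r = (swapnat i j (r %/ n) * n + r %% n)%N :> nat.
Proof.
rewrite inordK // -/m [X in (_ < X)%N]size_prednK.
have s : (swapnat i j (r %/ n) < k)%N.
  by rewrite /swapnat; do 2 case: ifP => _ //; exact: block_lt.
apply: (@leq_trans ((swapnat i j (r %/ n)).+1 * n)); last by rewrite leq_mul2r s orbT.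
by rewrite mulSn addnC ltn_add2r ltn_pmod.
Qed.

Lemma blockswap_idx_div (i j : 'I_k) (r : 'I_m.+1) :
  (blockswap_idx i j r %/ n)%N = swapnat i j (r %/ n).
Proof.
by rewrite blockswap_idxE divnMDl// (divn_small (ltn_pmod _ n_gt0)) addn0.
Qed.

Lemma blockswap_idxK (i j : 'I_k) : involutive (blockswap_idx i j).
Proof.
move=> r; apply/val_inj; rewrite /= blockswap_idxE blockswap_idx_div swapnatK.
by rewrite blockswap_idxE modnMDl modn_mod -divn_eq.
Qed.

(** Swapping the blocks of [p] and [q] carries [q] to some [q'] in the block of [p]; a transposition
    inside that block then exchanges [p] and [q']. *)
Lemma Ginvariant_transitive (phi : hvec R m -> R) :
  Ginvariant n k phi -> coord_transitive phi.
Proof.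
move=> [bs _ tr] p q.
pose i := Ordinal (block_lt p); pose j := Ordinal (block_lt q).
pose q' := blockswap_idx i j q.
exists (fun r => blockswap_idx i j (if r == p then q' else if r == q' then p else r)).
  move=> z; rewrite -[RHS](bs i j).
  rewrite -[RHS](tr p q') //.
  (* [p] and [q'] share a block, also when [p] and [q] already do and the swap is trivial. *)
  rewrite /q' blockswap_idx_div /swapnat /= eqxx.
  by case: eqP.
move=> r; rewrite (can2_eq (blockswap_idxK i j) (blockswap_idxK i j)) -/q'.
case: (eqVneq r p) => [_|rp]; first exact: eqxx.
by case: (eqVneq r q') => [rq|/negPf//]; rewrite -rq eq_sym (negPf rp).
Qed.

End group_transitivity.

(** * Comparison of [phi] with [psi] *)

Theorem theorem1 (R : realType) (k n : nat) (hk : (1 <= k)%N) (hn : (1 <= n)%N)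
  (a : R) (ha : 0 < a) (phi : hvec R (k * n).-1 -> R) :
  homog0 phi ->
  smoothP phi ->
  admissible a phi ->
  Ginvariant n k phi ->
  ereal_sup [set (phi z)%:E | z in [set z | hnonzero z]] = 0%E ->
  forall z : hvec R (k * n).-1, hnonzero z -> (psi a z <= (phi z)%:E)%E.
Proof.
move=> homog smooth adm G sup0 z _.
have [_ phase _] := G.
have phi_le0 w : hnonzero w -> phi w <= 0.
  move=> w0; suff : ((phi w)%:E <= 0)%E by [].
  by rewrite -sup0; apply: ereal_sup_ubound; exists w.
have le1 := phi_le_one homog smooth phase ha adm phi_le0.
have phi1 : 0 <= phi (fun=> 1) + a * ln (k * n).-1.+1%:R.
  suff : (0 <= (phi (fun=> 1) + a * ln (k * n).-1.+1%:R)%:E)%E by [].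
  rewrite -sup0; apply: ge_ereal_sup => _ [w w0 <-].
  by rewrite lee_fin; exact: le1.
rewrite /psi; case: ifPn => [/forallP z0|_]; last exact: leNye.
rewrite lee_fin.
have := log_monomial_le_phi homog smooth phase adm (Ginvariant_transitive hk hn G) phi1 z0.
(* Both lower bounds are equal: the logarithm turns the powers in [psi] into factors and the product
   into a sum. *)
apply: le_trans; rewrite le_eqVlt; apply/orP; left; apply/eqP.
have prod_gt0 : 0 < \prod_(p < (k * n).-1.+1) cabs (z p).
  by apply: prodr_gt0 => p _; exact: cabs_gt0.
have sum_gt0 : 0 < \sum_(p < (k * n).-1.+1) cabs (z p) ^+ 2.
  rewrite big_ord_recl ltr_wpDr ?exprn_gt0 ?cabs_gt0 //.
  by apply: sumr_ge0 => p _; rewrite exprn_ge0 ?cabs_ge0.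
rewrite ln_div ?posrE ?powR_gt0 // !ln_powR; congr (_ * _ - _).
rewrite -[RHS]expRK expR_sum; congr ln; apply: eq_bigr => p _.
by rewrite lnK // posrE cabs_gt0.
Qed.
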